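(* Let $m\ge 2$ and $n\ge 2$, and let $L_{m,n}$ be a graph consisting of the complete bipartite graph $K_{m,n}$ together with at least two additional end vertices, each adjacent to exactly one vertex of $K_{m,n}$ (and to nothing else), with distinct end vertices attached to distinct vertices of $K_{m,n}$. Then $L_{m,n}$ has no corresponding semigroups: there is no commutative zero-divisor semigroup $S$ with $\Gamma(S)\cong L_{m,n}$. In particular, the graph with six vertices $p,q,r,p',q',r'$ and exactly the six edges $pq$, $qr$, $p'q'$, $q'r'$, $pp'$, $qq'$ (a square with end vertices attached to two adjacent vertices) has no corresponding semigroups.
   Context: All semigroups are commutative, written multiplicatively, and have a zero element $0$ (so $0x=0$ for all $x$). An element $x$ of a semigroup $S$ is a zero-divisor if $xy=0$ for some $y\in S$ with $y\ne 0$. A zero-divisor semigroup is a commutative semigroup with $0$ all of whose elements are zero-divisors. The zero-divisor graph $\Gamma(S)$ is the undirected simple graph whose vertices are the nonzero zero-divisors of $S$, two distinct vertices $x,y$ being adjacent if and only if $xy=0$. A graph $G$ has corresponding semigroups if $\Gamma(S)\cong G$ for some commutative zero-divisor semigroup $S$. *)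

(* Defs.v *)
From HB Require Import structures.
From mathcomp Require Import all_boot.
From mathcomp Require Import boolp classical_sets.

Set Implicit Arguments.
Unset Strict Implicit.
Unset Printing Implicit Defensive.

Local Open Scope group_scope.

Record sgraph := SGraph {
  vertex :> Type;
  adj : rel vertex;
  adj_sym : symmetric adj;
  adj_irrefl : irreflexive adj
}.

Definition graph_iso (G H : sgraph) : Prop :=
  exists f : G -> H, bijective f /\ forall x y : G, adj (f x) (f y) = adj x y.

HB.mixin Record Semigroup_isComSemigroup0 S of Semigroup S := {
  mul_com : commutative (@mul S);
  szero : S;
  zero_mul : left_zero szero (@mul S)
}.

#[short(type="comSemigroup0Type")]
HB.structure Definition ComSemigroup0 :=
  {S of Semigroup_isComSemigroup0 S & Semigroup S}.

Definition zero_divisor (S : comSemigroup0Type) (x : S) : Prop :=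
  exists y : S, y != szero /\ x * y = szero.

(* [szero] itself has to be a zero-divisor, so the one-element semigroup is
   excluded. *)
Definition zero_divisor_semigroup (S : comSemigroup0Type) : Prop :=
  forall x : S, zero_divisor x.

Section ZeroDivisorGraph.
Variable S : comSemigroup0Type.

Definition nz_zero_divisors : set S :=
  [set x : S | x != szero /\ zero_divisor x]%classic.

Definition zdg_adj : rel (set_type nz_zero_divisors) :=
  fun x y => (x != y) && (val x * val y == szero).

Lemma zdg_adj_sym : symmetric zdg_adj.
Proof. by move=> x y; rewrite /zdg_adj eq_sym mul_com. Qed.

Lemma zdg_adj_irrefl : irreflexive zdg_adj.
Proof. by move=> x; rewrite /zdg_adj eqxx. Qed.

Definition zero_divisor_graph : sgraph := SGraph zdg_adj_sym zdg_adj_irrefl.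
End ZeroDivisorGraph.

Definition has_corresponding_semigroups (G : sgraph) : Prop :=
  exists S : comSemigroup0Type,
    zero_divisor_semigroup S /\ graph_iso (zero_divisor_graph S) G.

Section CompleteBipartite.
Variables m n : nat.

Definition Kmn_adj : rel ('I_m + 'I_n) := fun x y =>
  match x, y with
  | inl _, inr _ | inr _, inl _ => true
  | _, _ => false
  end.

Lemma Kmn_adj_sym : symmetric Kmn_adj.
Proof. by case=> x [] y. Qed.

Lemma Kmn_adj_irrefl : irreflexive Kmn_adj.
Proof. by case. Qed.

Definition complete_bipartite : sgraph := SGraph Kmn_adj_sym Kmn_adj_irrefl.
End CompleteBipartite.

(* The graph K_{m,n} with [k] end vertices added, the [i]-th one being adjacent
   to the vertex [a i] of K_{m,n} only. *)
Section EndVertices.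
Variables (m n k : nat) (a : 'I_k -> complete_bipartite m n).

Definition Lmn_adj : rel (complete_bipartite m n + 'I_k) := fun x y =>
  match x, y with
  | inl u, inl v => adj u v
  | inl u, inr i | inr i, inl u => u == a i :> 'I_m + 'I_n
  | inr _, inr _ => false
  end.

Lemma Lmn_adj_sym : symmetric Lmn_adj.
Proof. by case=> x [] y //=; exact: Kmn_adj_sym. Qed.

Lemma Lmn_adj_irrefl : irreflexive Lmn_adj.
Proof. by case=> x //=; exact: Kmn_adj_irrefl. Qed.

Definition complete_bipartite_with_ends : sgraph :=
  SGraph Lmn_adj_sym Lmn_adj_irrefl.
End EndVertices.

Inductive six := Vp | Vq | Vr | Vp' | Vq' | Vr'.

Definition six_edge (x y : six) : bool :=
  match x, y with
  | Vp, Vq | Vq, Vr | Vp', Vq' | Vq', Vr' | Vp, Vp' | Vq, Vq' => true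
  | _, _ => false
  end.

Definition six_adj : rel six := fun x y => six_edge x y || six_edge y x.

Lemma six_adj_sym : symmetric six_adj.
Proof. by move=> x y; rewrite /six_adj orbC. Qed.

Lemma six_adj_irrefl : irreflexive six_adj.
Proof. by case. Qed.

Definition six_graph : sgraph := SGraph six_adj_sym six_adj_irrefl.

(* Main.v *)
Require Import Defs.
From mathcomp Require Import all_boot.
From mathcomp Require Import boolp classical_sets.

(** Suppose that [S] realises [L_{m,n}], so that the nonzero elements of [S]
    are the vertices, and let [A] and [B] be the two sides of the bipartite
    part.  The annihilators of a product [s * t] contain those of [s] and of
    [t], so a product that does not vanish is a vertex whose neighbourhood is
    large, and the graph offers few such vertices.

    Concretely, let the end vertex [x] hang at [a] in [A] and let [u] be
    another vertex of [A].  Then [x * u] is nonzero and annihilates [B], hence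
    lies in [A]; it also annihilates [a], and [a] is the only element of [A]
    that can do so.  Hence [x * u = a] (lemma [end_mul]).

    If [x] and [y] hang at distinct [a] and [b] on the same side, then
    [x * b = a] and [y * a = b] give [a = x * y * a = 0].

    If [y] hangs at [b] on the other side, pick [u <> a] in [A] and [v <> b] in
    [B].  The element [x * y] annihilates [a] and [b], and the graph has no
    triangle through the edge [a b], so [x * y] is [0], [a] or [b].  But it
    annihilates neither [u], as [x * y * u = y * a], nor [v], as
    [x * y * v = x * b], and both values are nonzero.

    The six-vertex graph is [L_{2,2}] with end vertices at two adjacent
    vertices of the square. *)

Set Implicit Arguments.
Unset Strict Implicit.
Unset Printing Implicit Defensive.

Local Open Scope group_scope.

(** * End vertices in a semigroup *)

Section EndsInSemigroup.
Variable S : comSemigroup0Type.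
Implicit Types (s t u v x y a b : S) (A B : S -> Prop).

(** One side [A] of a bipartite part, relative to the other side [B].  The
    shape of the ambient graph enters through [side_ann]: nothing outside [A]
    is joined to the whole of [B]. *)
Record side A B : Prop := Side {
  side_neq0 : forall u, A u -> u <> szero;
  side_cross : forall u v, A u -> B v -> u * v = szero;
  side_indep : forall u v, A u -> A v -> u <> v -> u * v <> szero;
  side_ann : forall s, s <> szero -> (forall v, B v -> s * v = szero) -> A s
}.

Definition no_outer_triangle A B : Prop := forall s u v,
  s <> szero -> A u -> B v -> s * u = szero -> s * v = szero -> A s \/ B s.

Definition bipartite_core A B : Prop :=
  [/\ side A B, side B A & no_outer_triangle A B].

Definition end_at a x : Prop :=
  x * a = szero /\ forall s, x * s = szero -> [\/ s = szero, s = x | s = a].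

Lemma mulA0 s t u : t * u = szero -> s * t * u = szero.
Proof. by move=> tu0; rewrite -mulgA tu0 mul_com zero_mul. Qed.

(** [x * u] inherits the annihilators of [u], which puts it in [A], and those
    of [x], which singles out [a] in the independent set [A]. *)
Lemma end_mul A B a x u :
  side A B -> end_at a x -> A a -> A u -> u <> a -> x * u = a.
Proof.
move=> sA [xa0 annx] Aa Au uNa.
have xuN0 : x * u <> szero.
  case/annx=> [u0|ux|//]; first exact: (side_neq0 sA Au).
  by apply: (side_indep sA Au Aa uNa); rewrite ux.
have Axu : A (x * u).
  by apply: (side_ann sA xuN0) => v Bv; apply/mulA0/(side_cross sA Au Bv).
apply: contrapT => xuNa; apply: (side_indep sA Axu Aa xuNa).
by rewrite (mul_com x u); apply: mulA0.
Qed.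

Lemma no_ends_same_side A B a b x y :
  side A B -> A a -> A b -> a <> b -> end_at a x -> ~ end_at b y.
Proof.
move=> sA Aa Ab aNb ex ey.
have xb := end_mul sA ex Aa Ab (nesym aNb).
have ya := end_mul sA ey Ab Aa aNb.
apply: (side_neq0 sA Aa).
by rewrite -xb -ya mulgA (mul_com x y); apply: mulA0; case: ex.
Qed.

(** The only neighbour of [x] is [a], which cannot be [b]; nor can [x] be [b],
    because [x * u = a] while [b] kills all of [A]. *)
Lemma end_mul_cross_neq0 A B a b u x :
  side A B -> side B A -> A a -> A u -> u <> a -> B b -> end_at a x ->
  x * b <> szero.
Proof.
move=> sA sB Aa Au uNa Bb ex.
have xu := end_mul sA ex Aa Au uNa; case: (ex) => xa0 annx.
have bu0 := side_cross sB Bb Au.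
case/annx => [b0|bx|ba]; first exact: (side_neq0 sB Bb).
- by apply: (side_neq0 sA Aa); rewrite -xu -bx.
- by apply: (side_indep sA Aa Au (nesym uNa)); rewrite -ba.
Qed.

Lemma no_ends_opposite_sides A B a b u v x y :
  bipartite_core A B -> A a -> A u -> u <> a -> B b -> B v -> v <> b ->
  end_at a x -> ~ end_at b y.
Proof.
move=> [sA sB tri] Aa Au uNa Bb Bv vNb ex ey.
have xu := end_mul sA ex Aa Au uNa.
have yv := end_mul sB ey Bb Bv vNb.
have xbN0 := end_mul_cross_neq0 sA sB Aa Au uNa Bb ex.
have yaN0 := end_mul_cross_neq0 sB sA Bb Bv vNb Aa ey.
have xyu : x * y * u = y * a by rewrite (mul_com x y) -mulgA xu.
have xyv : x * y * v = x * b by rewrite -mulgA yv.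
have xyN0 : x * y <> szero by move=> xy0; apply: yaN0; rewrite -xyu xy0 zero_mul.
have xya0 : x * y * a = szero by rewrite (mul_com x y); apply: mulA0; case: ex.
have xyb0 : x * y * b = szero by apply: mulA0; case: ey.
case: (tri _ _ _ xyN0 Aa Bb xya0 xyb0) => [Axy|Bxy].
- by apply: xbN0; rewrite -xyv; exact: (side_cross sA Axy Bv).
- by apply: yaN0; rewrite -xyu; exact: (side_cross sB Bxy Au).
Qed.

End EndsInSemigroup.

(** * Reading a graph inside a semigroup *)

Record realisation (S : comSemigroup0Type) (G : sgraph) (phi : G -> S) : Prop :=
  Realisation {
    real_inj : injective phi;
    real_neq0 : forall v, phi v <> szero;
    real_surj : forall s, s <> szero -> exists v, s = phi v;
    real_adj : forall u v, u <> v -> phi u * phi v = szero <-> adj u v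
  }.

Definition vertex_image (S G : Type) (phi : G -> S) (P : G -> Prop) (s : S) : Prop :=
  exists2 v, P v & s = phi v.

(** Reduces [side] to adjacency alone.  The last premise asks for [w <> v]
    because the graph does not record the square [w * w]. *)
Lemma realisation_side (S : comSemigroup0Type) (G : sgraph) (phi : G -> S)
    (P Q : G -> Prop) :
  realisation phi ->
  (forall u v, P u -> Q v -> adj u v) ->
  (forall u v, P u -> P v -> ~~ adj u v) ->
  (forall w, ~ P w -> exists v, [/\ Q v, w <> v & ~~ adj w v]) ->
  side (vertex_image phi P) (vertex_image phi Q).
Proof.
move=> phiR cross indep missed.
split=> [_ [u _ ->]|_ _ [u Pu ->] [v Qv ->]|
  _ _ [u Pu ->] [v Pv ->] neq|s sN0].
- exact: (real_neq0 phiR).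
- have uv := cross _ _ Pu Qv; apply/(real_adj phiR) => // uEv.
  by move: uv; rewrite uEv adj_irrefl.
- have uNv : u <> v by move=> e; apply: neq; rewrite e.
  by move/(real_adj phiR uNv); apply/negP/indep.
have [w ->] := real_surj phiR sN0; move=> annQ.
exists w => //; apply: contrapT => /missed[v [Qv wNv]]; apply/negP; rewrite negbK.
by apply/(real_adj phiR wNv)/annQ; exists v.
Qed.

(** The vertices are all the nonzero elements of [S] because every element of
    [S] is a zero-divisor. *)
Lemma has_corresponding_realisation (G : sgraph) :
  has_corresponding_semigroups G ->
  exists (S : comSemigroup0Type) (phi : G -> S), realisation phi.
Proof.
case=> S [zdS [f [[g fK gK] f_adj]]].
exists S, (fun v => val (g v)); split.
- by move=> u v /val_inj /(can_inj gK).
- by move=> v; have /set_mem[/eqP] := valP (g v).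
- move=> s /eqP sN0.
  have s_in : s \in @nz_zero_divisors S by apply/mem_set.
  by exists (f (exist _ s s_in)); rewrite fK.
- move=> u v uNv; rewrite -{2}(gK u) -{2}(gK v) f_adj /= /zdg_adj.
  have -> /= : g u != g v by apply/eqP => /(can_inj gK).
  by split=> [->|/eqP].
Qed.

Lemma has_corresponding_iso (G H : sgraph) :
  graph_iso G H -> has_corresponding_semigroups G ->
  has_corresponding_semigroups H.
Proof.
case=> h [h_bij h_adj] [S [zdS [f [f_bij f_adj]]]].
exists S; split=> //; exists (h \o f); split; first exact: bij_comp.
by move=> x y /=; rewrite h_adj f_adj.
Qed.

(** * Complete bipartite graphs with end vertices *)

Lemma ord_neq_exists n (i : 'I_n) : 2 <= n -> exists j : 'I_n, j <> i.
Proof.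
move=> n2; have n0 : 0 < n by apply: leq_trans n2.
case: (eqVneq i (Ordinal n0)) => [->|/eqP iN]; last by exists (Ordinal n0) => /esym.
by exists (Ordinal n2).
Qed.

Section Lmn.
Variables (m n k : nat) (a : 'I_k -> complete_bipartite m n).
Hypotheses (m2 : 2 <= m) (n2 : 2 <= n).
Variables (S : comSemigroup0Type) (phi : complete_bipartite_with_ends a -> S).
Hypothesis phiR : realisation phi.

Let isL (v : complete_bipartite_with_ends a) : Prop :=
  if v is inl (inl _) then True else False.
Let isR (v : complete_bipartite_with_ends a) : Prop :=
  if v is inl (inr _) then True else False.

(** A vertex off the left side misses some right vertex: a right vertex misses
    the other ones, and an end vertex has only one neighbour. *)
Lemma side_left : side (vertex_image phi isL) (vertex_image phi isR).
Proof.
apply: realisation_side phiR _ _ _ => [[[u|u]|u] [[v|v]|v]|[[u|u]|u] [[v|v]|v]|] //.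
case=> [[i|j]|e] notL; first by case: notL.
  by have [j' neq] := ord_neq_exists j n2; exists (inl (inr j')); split=> // -[] /esym.
have [j jN] : exists j, inr j <> a e :> 'I_m + 'I_n.
  case: (a e) => [i|j]; first by exists (Ordinal n2).
  by have [j' neq] := ord_neq_exists j n2; exists j' => -[].
by exists (inl (inr j)); split=> //; apply/eqP.
Qed.

Lemma side_right : side (vertex_image phi isR) (vertex_image phi isL).
Proof.
apply: realisation_side phiR _ _ _ => [[[u|u]|u] [[v|v]|v]|[[u|u]|u] [[v|v]|v]|] //.
case=> [[i|j]|e] notR; [|by case: notR|].
  by have [i' neq] := ord_neq_exists i m2; exists (inl (inl i')); split=> // -[] /esym.
have [i iN] : exists i, inl i <> a e :> 'I_m + 'I_n.
  case: (a e) => [i|j]; last by exists (Ordinal m2).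
  by have [i' neq] := ord_neq_exists i m2; exists i' => -[].
by exists (inl (inl i)); split=> //; apply/eqP.
Qed.

Lemma core_Lmn : bipartite_core (vertex_image phi isL) (vertex_image phi isR).
Proof.
split; [exact: side_left|exact: side_right|].
move=> s _ _ /(real_surj phiR)[w ->] [[[i|?]|?] // _ ->] [[[?|j]|?] // _ ->].
case: w => [[i'|j']|e]; [by left; exists (inl (inl i'))|by right; exists (inl (inr j'))|].
move=> /(real_adj phiR) ei /(real_adj phiR) ej.
have /eqP ai : inl i == a e :> 'I_m + 'I_n by apply: ei.
have /eqP : inr j == a e :> 'I_m + 'I_n by apply: ej.
by rewrite -ai.
Qed.

Lemma end_Lmn e : end_at (phi (inl (a e))) (phi (inr e)).
Proof.
split; first by apply/(real_adj phiR) => //=.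
move=> s; case: (pselect (s = szero)) => [->|]; first by constructor 1.
case/(real_surj phiR) => v ->.
case: (pselect (v = inr e)) => [->|vNe]; first by constructor 2.
move=> /(real_adj phiR (nesym vNe)).
by case: v vNe => // u _ /eqP ->; constructor 3.
Qed.

Lemma ends_Lmn_opposite e e' i j : a e = inl i -> a e' = inr j -> False.
Proof.
have ex := end_Lmn e; have ey := end_Lmn e' => ai aj.
rewrite ai in ex; rewrite aj in ey.
have [i' i'N] := ord_neq_exists i m2; have [j' j'N] := ord_neq_exists j n2.
apply: (no_ends_opposite_sides (u := phi (inl (inl i'))) (v := phi (inl (inr j')))
  core_Lmn _ _ _ _ _ _ ex ey).
- by exists (inl (inl i)).
- by exists (inl (inl i')).
- by move=> /(real_inj phiR)[].
- by exists (inl (inr j)).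
- by exists (inl (inr j')).
- by move=> /(real_inj phiR)[].
Qed.

Lemma ends_Lmn_eq e e' : a e = a e'.
Proof.
have [sL sR _] := core_Lmn.
have ex := end_Lmn e; have ey := end_Lmn e'.
apply: contrapT => neq.
have phiN : phi (inl (a e)) <> phi (inl (a e')) by move=> /(real_inj phiR)[].
move: (@ends_Lmn_opposite e e') (@ends_Lmn_opposite e' e).
case: (a e) ex phiN => [i|j]; case: (a e') ey => [i'|j'] ey ex phiN opp opp'.
- by apply: (no_ends_same_side sL _ _ phiN ex ey);
    [exists (inl (inl i)) | exists (inl (inl i'))].
- exact: opp.
- exact: opp'.
- by apply: (no_ends_same_side sR _ _ phiN ex ey);
    [exists (inl (inr j)) | exists (inl (inr j'))].
Qed.

End Lmn.

Lemma no_corresponding_Lmn (m n k : nat) (a : 'I_k -> complete_bipartite m n) :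
  2 <= m -> 2 <= n -> 2 <= k -> injective a ->
  ~ has_corresponding_semigroups (complete_bipartite_with_ends a).
Proof.
move=> m2 n2 k2 a_inj /has_corresponding_realisation[S [phi phiR]].
have [e' []] := ord_neq_exists (Ordinal k2) k2.
by apply: a_inj; apply: (ends_Lmn_eq m2 n2 phiR).
Qed.

(** * The six-vertex graph *)

Definition square_ends (e : 'I_2) : complete_bipartite 2 2 :=
  if e == ord0 then inl ord0 else inr ord0.

(** The square [p q q' p'] has sides [{q, p'}] and [{q', p}]; the end vertices
    [r] and [r'] hang at [q] and [q']. *)
Definition six_to_square (x : six) : complete_bipartite_with_ends square_ends :=
  match x with
  | Vq => inl (inl ord0) | Vp' => inl (inl ord_max)
  | Vq' => inl (inr ord0) | Vp => inl (inr ord_max)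
  | Vr => inr ord0 | Vr' => inr ord_max
  end.

Definition square_to_six (v : complete_bipartite_with_ends square_ends) : six :=
  match v with
  | inl (inl i) => if i == ord0 then Vq else Vp'
  | inl (inr j) => if j == ord0 then Vq' else Vp
  | inr e => if e == ord0 then Vr else Vr'
  end.

Lemma six_graph_iso :
  graph_iso six_graph (complete_bipartite_with_ends square_ends).
Proof.
exists six_to_square; split; last by case=> [] [].
exists square_to_six; first by case.
have ord2 (i : 'I_2) : i = ord0 \/ i = ord_max.
  by case: i => [[|[|//]] lt_i]; [left|right]; apply: val_inj.
by case=> [[i|j]|e] /=;
  [case: (ord2 i) => ->|case: (ord2 j) => ->|case: (ord2 e) => ->].
Qed.

Theorem corollary3p4 :
  (forall (m n k : nat) (a : 'I_k -> complete_bipartite m n),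
      2 <= m -> 2 <= n -> 2 <= k -> injective a ->
      ~ has_corresponding_semigroups (complete_bipartite_with_ends a))
  /\ ~ has_corresponding_semigroups six_graph.
Proof.
split; first exact: no_corresponding_Lmn.
move/(has_corresponding_iso six_graph_iso); apply: no_corresponding_Lmn => //.
by case=> [[|[|//]] lt_e] [[|[|//]] lt_e'] //= _; apply: val_inj.
Qed.
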